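(* Let $k$ be a positive integer and let $Z_k(q)=\sum_{n\ge -k} w_k(n)q^n$ be the unique weakly holomorphic modular function on $\mathrm{SL}_2(\mathbb{Z})$ satisfying $$Z_k(q)=q^{-k}\prod_{n\ge 2}\frac{1}{1-q^n}+O(q).$$ Then the following hold. (i) In terms of the partition function $p(n)$, $$Z_k(q)=p(k)+\bigl(J_k(\tau)-J_{k-1}(\tau)\bigr)+\sum_{n=1}^{k-1}p(n)\bigl(J_{k-n}(\tau)-J_{k-n-1}(\tau)\bigr).$$ (ii) Define the polynomial $\Omega_k(X_0,X_1,\dots)$ by $\Omega_k(X_0,X_1,\dots):=\mathrm{PP}\!\left(q^{-k}\prod_{n\ge2}\frac{1}{1-q^n}\right)$. Then $$Z_k(q)=\Omega_k(J_0(\tau),J_1(\tau),J_2(\tau),\dots).$$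
   Context: Here $q=e^{2\pi i\tau}$ with $\tau$ in the upper half-plane. A modular function on $\mathrm{SL}_2(\mathbb{Z})$ is weakly holomorphic if it is holomorphic on the upper half-plane and its poles (if any) are supported at the cusp $i\infty$. $p(n)$ denotes the number of integer partitions of $n$ (with $p(0)=1$). For each integer $d\ge 0$, $J_d(\tau)$ denotes the unique weakly holomorphic modular function on $\mathrm{SL}_2(\mathbb{Z})$ with $J_d(\tau)=q^{-d}+O(q)$; in particular $J_0=1$ and $J_1=j-744$, where $j$ is the Klein $j$-invariant. For a $q$-series $f(q)=a_{-m}q^{-m}+\dots+a_{-1}q^{-1}+a_0+a_1q+\cdots$, the principal part operator is $\mathrm{PP}(f):=a_{-m}X_m+\dots+a_{-1}X_1+a_0X_0$, a linear polynomial in formal variables $X_0,X_1,\dots$. *)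

(* Defs.v *)
From Stdlib Require Import Reals ZArith Lia.
From mathcomp Require Import all_boot.
From Coquelicot Require Import Coquelicot.

Open Scope C_scope.

(** * Partitions *)

(* A partition of n is a nonincreasing sequence of positive integers with sum
   n; such a sequence has at most n terms, each of them at most n. *)
Definition is_partition (n : nat) (s : seq nat) : bool :=
  [&& path.sorted geq s, all (fun i => 0 < i)%N s & sumn s == n].

Definition p (n : nat) : nat :=
  #|[set s : n.-bseq 'I_n.+1 | is_partition n (map val s)]|.

(** * Formal power series and q-series *)

Definition fps := nat -> C.

Definition fps_one : fps := fun n => if (n == 0)%N then RtoC 1 else RtoC 0.

Definition fps_mul (f g : fps) : fps :=
  fun n => sum_n (fun i => f i * g (n - i)%N) n.

(* 1 - q^m *)
Definition fps_one_sub_qpow (m : nat) : fps :=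
  fun n => fps_one n - (if (n == m)%N then RtoC 1 else RtoC 0).

(* 1 / (1 - q^m), see [fps_geomK] *)
Definition fps_geom (m : nat) : fps := fun n => if (m %| n)%N then RtoC 1 else RtoC 0.

(* The partial product of 1 / (1 - q^n) over 2 <= n <= N + 1 *)
Fixpoint euler2_partial (N : nat) : fps :=
  match N with
  | O => fps_one
  | S N' => fps_mul (euler2_partial N') (fps_geom N'.+2)
  end.

(* The product of 1 / (1 - q^n) over all n >= 2: the n-th coefficient of the
   partial products is constant from N = n on, see [euler2_partial_stable]. *)
Definition euler2 : fps := fun n => euler2_partial n n.

(* The formal series sum_(n >= 0) qs_coef n * q^(n - qs_pole) *)
Record qseries := QSeries { qs_pole : nat; qs_coef : fps }.

Definition coefq (f : qseries) (n : Z) : C :=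
  let i := (n + Z.of_nat (qs_pole f))%Z in
  if (i <? 0)%Z then RtoC 0 else qs_coef f (Z.to_nat i).

(* f = g + O(q) *)
Definition eq_mod_Oq (f g : qseries) : Prop :=
  forall n : Z, (n <= 0)%Z -> coefq f n = coefq g n.

(** * Polynomials in X_0, X_1, ... and the principal part *)

(* Polynomial expressions; they are only used through substitution. *)
Inductive polyX :=
  | Pcst of C
  | PX of nat
  | Padd of polyX & polyX
  | Pmul of polyX & polyX.

Fixpoint peval (P : polyX) (x : nat -> C) : C :=
  match P with
  | Pcst c => c
  | PX i => x i
  | Padd P1 P2 => peval P1 x + peval P2 x
  | Pmul P1 P2 => peval P1 x * peval P2 x
  end.

(* a_(-m) X_m + ... + a_(-1) X_1 + a_0 X_0 *)
Fixpoint PP_upto (f : qseries) (m : nat) : polyX :=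
  let t := Pmul (Pcst (coefq f (- Z.of_nat m))) (PX m) in
  match m with
  | O => t
  | S m' => Padd t (PP_upto f m')
  end.

Definition PP (f : qseries) : polyX := PP_upto f (qs_pole f).

(** * Weakly holomorphic modular functions on SL_2(Z) *)

(* Functions on the upper half-plane are total functions C -> C whose values
   off the upper half-plane are irrelevant. *)
Definition upper (tau : C) : Prop := (0 < Im tau)%R.

Definition eq_on_upper (f g : C -> C) : Prop :=
  forall tau, upper tau -> f tau = g tau.

Definition Cexp (z : C) : C :=
  RtoC (exp (Re z)) * (cos (Im z), sin (Im z)).

(* q^n for q = e^(2 pi i tau) *)
Definition qpow (tau : C) (n : Z) : C :=
  Cexp (2 * RtoC PI * Ci * RtoC (IZR n) * tau).

Definition has_qexp (f : C -> C) (s : qseries) : Prop :=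
  forall tau, upper tau ->
    @is_series C_AbsRing C_NormedModule
      (fun n : nat =>
         qs_coef s n * qpow tau (Z.of_nat n - Z.of_nat (qs_pole s)))
      (f tau).

Definition holomorphic_upper (f : C -> C) : Prop :=
  forall tau, upper tau -> @ex_derive C_AbsRing C_NormedModule f tau.

Definition SL2Z_invariant (f : C -> C) : Prop :=
  forall (a b c d : Z) (tau : C), (a * d - b * c = 1)%Z -> upper tau ->
    f ((RtoC (IZR a) * tau + RtoC (IZR b)) /
       (RtoC (IZR c) * tau + RtoC (IZR d))) = f tau.

Definition weakly_holomorphic (f : C -> C) : Prop :=
  [/\ holomorphic_upper f, SL2Z_invariant f & exists s, has_qexp f s].

(* f is a weakly holomorphic modular function with f = g + O(q) *)
Definition modular_with_pp (f : C -> C) (g : qseries) : Prop :=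
  weakly_holomorphic f /\ exists2 s, has_qexp f s & eq_mod_Oq s g.

Definition is_J (d : nat) (f : C -> C) : Prop :=
  modular_with_pp f (QSeries d fps_one).

(* q^(-k) times the product of 1 / (1 - q^n) over n >= 2 *)
Definition Zk_target (k : nat) : qseries := QSeries k euler2.

Definition is_Z (k : nat) (f : C -> C) : Prop :=
  modular_with_pp f (Zk_target k).

Definition Omega (k : nat) : polyX := PP (Zk_target k).

(** * Correctness of the product expansion *)

Lemma sum_n_eq0 (u : nat -> C) (n : nat) :
  (forall i, (i <= n)%N -> u i = 0) -> sum_n u n = RtoC 0.
Proof.
elim: n => [|n IHn] u0; first by rewrite sum_O u0.
rewrite sum_Sn IHn => [|i lei]; last by apply: u0; apply: leqW.
by rewrite u0 //; apply: plus_zero_l.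
Qed.

Lemma sum_n_single (u : nat -> C) (j n : nat) : (j <= n)%N ->
  (forall i, (i <= n)%N -> i <> j -> u i = 0) -> sum_n u n = u j.
Proof.
elim: n => [|n IHn] lej u0; first by move: lej; rewrite leqn0 => /eqP ->; rewrite sum_O.
rewrite sum_Sn; move: lej; rewrite leq_eqVlt => /orP [/eqP ej|ltj].
- rewrite sum_n_eq0 => [|i lei]; first by rewrite ej; apply: plus_zero_l.
  by apply: u0; [apply: leqW | move=> ei; move: lei; rewrite ei ej ltnn].
- rewrite IHn //; last by move=> i lei; apply: u0; apply: leqW.
  rewrite (u0 n.+1) //; first by apply: plus_zero_r.
  by move=> ej; move: ltj; rewrite ej ltnn.
Qed.

Lemma fps_geomK (m n : nat) : (0 < m)%N ->
  fps_mul (fps_one_sub_qpow m) (fps_geom m) n = fps_one n.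
Proof.
move=> m0; rewrite /fps_mul /fps_one_sub_qpow.
rewrite (sum_n_ext _ (fun i => plus (fps_one i * fps_geom m (n - i)%N)
   (- (if (i == m)%N then RtoC 1 else RtoC 0) * fps_geom m (n - i)%N))); last first.
  by move=> i; rewrite /plus /=; ring.
rewrite sum_n_plus (sum_n_single _ 0%N) //; last first.
  by move=> i _ /eqP/negbTE i0; rewrite /fps_one i0; ring.
rewrite (_ : fps_one 0%N = RtoC 1) // subn0 /plus /=.
case: (leqP m n) => [lemn|ltnm].
- rewrite (sum_n_single _ m) //; last first.
    by move=> i _ /eqP/negbTE im; rewrite im; ring.
  rewrite eqxx /fps_geom /fps_one dvdn_subl //.
  by rewrite eqn0Ngt (leq_trans m0 lemn); case: ifP => _ /=; ring.
- rewrite sum_n_eq0; last first.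
    move=> i lei; have /negbTE -> : i != m; last by ring.
    by apply/eqP => im; move: lei; rewrite im leqNgt ltnm.
  rewrite /fps_geom /fps_one.
  case: (posnP n) => [->|n0]; first by rewrite dvdn0; ring.
  by rewrite gtnNdvd //; ring.
Qed.

Lemma euler2_partial_stable (N n : nat) : (n <= N)%N ->
  euler2_partial N n = euler2 n.
Proof.
elim: N => [|N IHN]; first by rewrite leqn0 => /eqP ->.
rewrite leq_eqVlt => /orP [/eqP -> //|len].
rewrite /= /fps_mul (sum_n_single _ n) //.
  by rewrite subnn /fps_geom dvdn0 IHN //; ring.
move=> i lei /eqP nein; rewrite /fps_geom gtnNdvd; first by ring.
  by rewrite subn_gt0 ltn_neqAle nein.
by rewrite ltnS; apply: leq_trans (leq_subr i n) _; apply: ltnW.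
Qed.

(* Main.v *)
Require Import Defs.
From Stdlib Require Import Reals ZArith Lra Lia FunctionalExtensionality.
From Corelib Require Import ssreflect ssrbool.
From mathcomp Require all_boot.
From Coquelicot Require Import Coquelicot.

(** Uniqueness amounts to showing that an invariant [f = sum_(n >= 1) b_n q^n]
    vanishes. Every orbit meets the half-plane [Im tau >= 1/2]. If [|f| <= M]
    everywhere, the Cauchy estimates on the line [Im tau = 1/8] give
    [|b_n| e^(-pi n / 4) <= M]; as [e^(-3 pi / 4) <= 1/3], summing from [n = 1]
    gives [|f| <= M / 2] on [Im tau >= 1/2], hence everywhere, and the bound can
    be halved for ever. The function [Omega_k (J_0, J_1, ...)] has the principal
    part required of [Z_k], so both are equal. Finally the product over
    [n >= 2] is [1 - q] times the generating function of [p], so its coefficients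
    have partial sums [p n] and formula (i) is (ii) after Abel summation. *)

Open Scope C_scope.

Local Notation is_Cseries := (@is_series C_AbsRing C_NormedModule).

(** * The exponential and complex series *)

Lemma Cexp_plus (a b : C) : Cexp (a + b) = Cexp a * Cexp b.
Proof.
rewrite /Cexp; case: a => a1 a2; case: b => b1 b2 /=.
rewrite exp_plus cos_plus sin_plus /Cmult /RtoC /=; f_equal; ring.
Qed.

Lemma Cmod_Cexp (z : C) : Cmod (Cexp z) = exp (Re z).
Proof.
rewrite /Cexp Cmod_mult Cmod_R Rabs_pos_eq; last by apply/Rlt_le/exp_pos.
have -> : Cmod (cos (Im z), sin (Im z)) = 1%R; last by ring.
rewrite /Cmod -sqrt_1 -(sin2_cos2 (Im z)) /Rsqr /=; f_equal; ring.
Qed.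

Lemma Cexp_0 : Cexp 0 = 1.
Proof. by rewrite /Cexp /= exp_0 cos_0 sin_0 /Cmult /RtoC /=; f_equal; ring. Qed.

Lemma qpow_0 (tau : C) : qpow tau 0 = 1.
Proof. rewrite /qpow -Cexp_0; f_equal; ring. Qed.

Lemma Cmod_qpow (tau : C) (n : Z) :
  Cmod (qpow tau n) = exp (- (2 * PI * IZR n * Im tau)).
Proof.
rewrite /qpow Cmod_Cexp; f_equal.
case: tau => x y; rewrite /Cmult /RtoC /Ci /=; ring.
Qed.

(** On a horizontal line [q^n] is a unimodular character of the real part times a fixed factor, so
    averaging along the line can isolate one coefficient. *)
Lemma qpow_real_shift (x y : R) (n : Z) :
  qpow (x, y) n = Cexp (0, 2 * PI * IZR n * x)%R * qpow (0, y)%R n.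
Proof.
rewrite /qpow -Cexp_plus; f_equal.
rewrite /Cmult /Cplus /RtoC /Ci /=; f_equal; ring.
Qed.

Lemma Cmod_sum_n_le (u : nat -> C) (n : nat) :
  Cmod (@sum_n C_AbelianMonoid u n) <= sum_n (fun i => Cmod (u i)) n.
Proof.
elim: n => [|n IHn]; first by rewrite !sum_O; apply: Rle_refl.
rewrite !sum_Sn; apply: Rle_trans (Cmod_triangle _ _) _.
by apply: Rplus_le_compat_r.
Qed.

Lemma is_Cseries_Cmod (u : nat -> C) (l : C) : is_Cseries u l ->
  is_lim_seq (fun n => Cmod (@sum_n C_AbelianMonoid u n)) (Cmod l).
Proof.
move=> Hu; rewrite /is_lim_seq.
exact: (filterlim_comp _ _ _ _ _ _ _ _ Hu (@filterlim_norm C_AbsRing C_NormedModule l)).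
Qed.

Lemma is_Cseries_bounded (u : nat -> C) (l : C) : is_Cseries u l ->
  exists B : R, forall n, Cmod (u n) <= B.
Proof.
move=> /is_Cseries_Cmod Hl.
have [M HM] : exists M, forall n, Cmod (@sum_n C_AbelianMonoid u n) <= M.
  case: (maj_by_pos (fun n => Cmod (@sum_n C_AbelianMonoid u n))).
    by exists (Cmod l); apply/is_lim_seq_Reals.
  move=> M [_ HM]; exists M => n; move: (HM n); rewrite Rabs_pos_eq //; apply: Cmod_ge_0.
exists (2 * M)%R => -[|n].
  move: (HM 0%nat) (Cmod_ge_0 (u 0%nat)); rewrite sum_O; lra.
move: (HM n) (HM (S n)); rewrite sum_Sn => H1 H2.
have -> : u (S n) = (plus (sum_n u n) (u (S n)) : C) + - sum_n u n.
  rewrite /plus /=; ring.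
apply: Rle_trans (Cmod_triangle _ _) _; rewrite Cmod_opp; lra.
Qed.

(** * Cauchy estimates by averaging over roots of unity *)

Lemma is_Cseries_sum (u : nat -> nat -> C) (l : nat -> C) (N : nat) :
  (forall j, is_Cseries (u j) (l j)) ->
  is_Cseries (fun m => @sum_n C_AbelianMonoid (fun j => u j m) N)
    (@sum_n C_AbelianMonoid l N).
Proof.
move=> Hu; elim: N => [|N IHN].
  by rewrite sum_O; apply: is_series_ext (Hu 0%nat) => m; rewrite sum_O.
rewrite sum_Sn; apply: is_series_ext (is_series_plus _ _ _ _ IHN (Hu (S N))) => m.
by rewrite sum_Sn.
Qed.

(** Partial sums past [N] differ from [u n] only by a geometric tail. In the application, sampling
    at [N + 1] points cancels every frequency up to [N] except [n], and the tail holds those that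
    may alias with it. *)
Lemma Cmod_term_le (u : nat -> C) (l : C) (n N : nat) (B t : R) :
  0 <= t < 1 -> (n <= N)%nat ->
  (forall m, (m <= N)%nat -> m <> n -> u m = 0) ->
  (forall m, Cmod (u m) <= B * t ^ m) ->
  is_Cseries u l -> Cmod (u n) <= Cmod l + B / (1 - t) * t ^ N.
Proof.
move=> [t0 t1] lenN u0 uB Hu.
have B0 : 0 <= B by move: (uB 0%nat) (Cmod_ge_0 (u 0%nat)) => /=; lra.
(* Keeping [- t ^ (N + k)] lets the induction close: one step raises the bound by [B * t ^ (N + k)],
   which dominates the new term. *)
have tail k : Cmod (@sum_n C_AbelianMonoid u (N + k) - u n)
              <= B / (1 - t) * (t ^ N - t ^ (N + k)).
  elim: k => [|k IHk].
    have -> : @sum_n C_AbelianMonoid u (N + 0) = u n.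
      rewrite Nat.add_0_r; apply: sum_n_single; first by apply/ssrnat.leP.
      by move=> m /ssrnat.leP; apply: u0.
    rewrite Nat.add_0_r /Cminus Cplus_opp_r Cmod_0; lra.
  rewrite Nat.add_succ_r sum_Sn.
  have -> : plus (@sum_n C_AbelianMonoid u (N + k)) (u (S (N + k))) - u n
            = (@sum_n C_AbelianMonoid u (N + k) - u n) + u (S (N + k)).
    rewrite /plus /=; ring.
  apply: Rle_trans (Cmod_triangle _ _) _.
  have step : (B / (1 - t) * (t ^ N - t ^ S (N + k)))%R =
              (B / (1 - t) * (t ^ N - t ^ (N + k)) + B * t ^ (N + k))%R.
    rewrite /=; field; lra.
  rewrite step; apply: Rplus_le_compat IHk _; apply: Rle_trans (uB _) _ => /=.
  have tp : 0 <= t ^ (N + k) by apply: pow_le.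
  apply: Rmult_le_compat_l => //; nra.
have lim : is_lim_seq (fun k => Cmod (@sum_n C_AbelianMonoid u k)) (Cmod l)
  by apply: is_Cseries_Cmod.
have /is_lim_seq_incr_n {}lim := lim; move: (lim N) => {}lim.
have BN : 0 <= B / (1 - t) by apply: Rdiv_le_0_compat; lra.
have := is_lim_seq_le (fun _ => Cmod (u n) - B / (1 - t) * t ^ N)%R _ _ _ _
   (is_lim_seq_const _) lim.
rewrite /Rbar_le => H; suff : (Cmod (u n) - B / (1 - t) * t ^ N)%R <= Cmod l by lra.
apply: H => k; rewrite Nat.add_comm.
have tp : 0 <= t ^ (N + k) by apply: pow_le.
have {1}-> : u n = @sum_n C_AbelianMonoid u (N + k) +
   - (@sum_n C_AbelianMonoid u (N + k) - u n) by ring.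
have := Cmod_triangle (@sum_n C_AbelianMonoid u (N + k))
   (- (@sum_n C_AbelianMonoid u (N + k) - u n)); rewrite Cmod_opp.
move: (tail k); nra.
Qed.

Lemma Cexp_double (x : R) :
  Cexp (0, 2 * x)%R = (1 - 2 * sin x * sin x, 2 * sin x * cos x)%R.
Proof. by rewrite /Cexp /= exp_0 Cmult_1_l cos_2a_sin sin_2a. Qed.

Lemma Cexp_2PI (k : Z) : Cexp (0, 2 * (IZR k * PI))%R = 1.
Proof.
rewrite Cexp_double sin_eq_0_1; last by exists k.
by rewrite /RtoC; f_equal; ring.
Qed.

(** By [Cexp_double], the value 1 would make the sine vanish at [k PI / (N + 1)], an angle that up
    to sign lies strictly between 0 and [PI]. *)
Lemma root_of_unity_neq1 (k : Z) (N : nat) : k <> 0%Z -> (Z.abs k <= Z.of_nat N)%Z ->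
  Cexp (0, 2 * (IZR k * PI / INR (S N)))%R <> 1.
Proof.
move=> k0 kN; set x := (_ / _)%R; rewrite Cexp_double => -[H _].
have {}H : sin x = 0%R by apply: Rsqr_0_uniq; rewrite /Rsqr; lra.
have HN : 0 < INR (S N) by apply: lt_0_INR; lia.
have pos (j : Z) : (0 < j <= Z.of_nat N)%Z -> 0 < sin (IZR j * PI / INR (S N)).
  move=> [j0 jN]; have PI0 := PI_RGT_0; have j0' := IZR_lt _ _ j0.
  apply: sin_gt_0; first by apply: Rdiv_lt_0_compat => //; nra.
  have : (IZR j < INR (S N))%R by rewrite INR_IZR_INZ; apply: IZR_lt; lia.
  move=> jN'; apply/Rlt_div_l => //; nra.
case: (Z_lt_le_dec 0 k) => kpos.
  by have := pos k ltac:(lia); rewrite -/x; lra.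
have := pos (- k)%Z ltac:(lia); rewrite opp_IZR.
have -> : (- IZR k * PI / INR (S N) = - x)%R by rewrite /x; field; lra.
rewrite sin_neg; lra.
Qed.

Lemma sum_roots_of_unity (k : Z) (N : nat) :
  k <> 0%Z -> (Z.abs k <= Z.of_nat N)%Z ->
  @sum_n C_AbelianMonoid
    (fun j => Cexp (0, 2 * (IZR k * PI / INR (S N)) * INR j)%R) N = RtoC 0.
Proof.
move=> k0 kN; set w := (2 * (IZR k * PI / INR (S N)))%R.
have geo M : (Cexp (0, w)%R - 1) *
   @sum_n C_AbelianMonoid (fun j => Cexp (0, w * INR j)%R) M
   = Cexp (0, w * INR (S M))%R - 1.
  elim: M => [|M IHM].
    rewrite sum_O /= Rmult_0_r Rmult_1_r -/(RtoC 0) Cexp_0; ring.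
  rewrite sum_Sn; change (@plus C_AbelianMonoid) with Cplus; rewrite Cmult_plus_distr_l IHM.
  have -> : (0, w * INR (S (S M)))%R = (0, w)%R + (0, w * INR (S M))%R :> C.
    rewrite (S_INR (S M)) /Cplus /=; f_equal; ring.
  rewrite Cexp_plus; ring.
have HN : 0 < INR (S N) by apply: lt_0_INR; lia.
have := geo N; have -> : (w * INR (S N))%R = (2 * (IZR k * PI))%R.
  by rewrite /w; field; lra.
rewrite Cexp_2PI => H.
have w1 : Cexp (0, w)%R - 1 <> 0.
  move=> e; apply: (root_of_unity_neq1 k N k0 kN); rewrite -/w.
  by rewrite -(Cplus_0_l 1) -e; ring.
have {}H : (Cexp (0, w)%R - 1) *
   @sum_n C_AbelianMonoid (fun j => Cexp (0, w * INR j)%R) N = 0 by rewrite H; ring.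
rewrite -[LHS]Cmult_1_l -(Cinv_l _ w1) -Cmult_assoc H; apply: Cmult_0_r.
Qed.

Definition qser (b : nat -> C) (f : C -> C) : Prop :=
  forall tau, upper tau -> is_Cseries (fun n => b n * qpow tau (Z.of_nat n)) (f tau).

Lemma Cmod_qpow_nat (tau : C) (n : nat) :
  Cmod (qpow tau (Z.of_nat n)) = (exp (- (2 * PI * Im tau)) ^ n)%R.
Proof.
rewrite Cmod_qpow -INR_IZR_INZ; elim: n => [|n IHn].
  by rewrite /= -exp_0; f_equal; ring.
rewrite S_INR -tech_pow_Rmult -IHn -exp_plus; f_equal; ring.
Qed.

Lemma qser_coef_bounded (b : nat -> C) (f : C -> C) (y : R) : qser b f -> 0 < y ->
  exists B, forall n, Cmod (b n) * exp (- (2 * PI * y)) ^ n <= B.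
Proof.
move=> Hf y0; have [B HB] := is_Cseries_bounded _ _ (Hf (0, y)%R y0).
by exists B => n; move: (HB n); rewrite Cmod_mult Cmod_qpow_nat.
Qed.

Lemma exp_neg_lt1 (x : R) : 0 < x -> 0 <= exp (- x) < 1.
Proof.
move=> x0; split; first by apply/Rlt_le/exp_pos.
rewrite -exp_0; apply: exp_increasing; lra.
Qed.

(** A finite average replaces the Cauchy integral: [f] is sampled at [j / (N + 1) + i y] against
    [e^(-2 pi i n x)]. Frequencies [m <= N] other than [n] cancel, and the decay assumed of the
    terms controls the others. *)
Lemma Cauchy_estimate_avg (b : nat -> C) (f : C -> C) (y M B t : R) (n N : nat) :
  qser b f -> 0 < y -> (forall x, Cmod (f (x, y)) <= M) ->
  0 <= t < 1 -> (forall m, Cmod (b m) * exp (- (2 * PI * y)) ^ m <= B * t ^ m) ->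
  (n <= N)%nat ->
  Cmod (b n) * exp (- (2 * PI * y)) ^ n <= M + B / (1 - t) * t ^ N.
Proof.
move=> Hf y0 HM Ht HB lenN.
have HN : 0 < INR (S N) by apply: lt_0_INR; lia.
(* [om j] is the weight of the [j]-th sample; [r m j] is the root of unity that frequency [m]
   contributes there once weighted. *)
pose r (m : nat) (j : nat) :=
  Cexp (0, 2 * (IZR (Z.of_nat m - Z.of_nat n) * PI / INR (S N)) * INR j)%R.
pose om j := Cexp (0, 2 * PI * - INR n * (INR j / INR (S N)))%R.
pose tau j : C := (INR j / INR (S N), y)%R.
have Cmod_im x : Cmod (Cexp (0, x)%R) = 1%R by rewrite Cmod_Cexp exp_0.
have Hs j : is_Cseries (fun m => (b m * qpow (0, y)%R (Z.of_nat m)) * r m j)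
              (om j * f (tau j)).
  apply: is_series_ext (is_series_scal (om j) _ _ (Hf (tau j) y0)) => m.
  rewrite /scal /= /mult /= /tau (qpow_real_shift (INR j / INR (S N))).
  have -> : r m j = om j * Cexp (0, 2 * PI * IZR (Z.of_nat m) * (INR j / INR (S N)))%R.
    rewrite /r /om -Cexp_plus; f_equal.
    rewrite /Cplus; cbn [fst snd]; f_equal; first by ring.
    rewrite minus_IZR -!INR_IZR_INZ; field; lra.
  ring.
have := is_Cseries_sum _ _ N Hs.
set u := (fun m => _); set l := sum_n _ N.
move=> Hu.
have uE m : u m = (b m * qpow (0, y)%R (Z.of_nat m)) * @sum_n C_AbelianMonoid (r m) N.
  by rewrite /u (@sum_n_mult_l C_Ring).
have Cmod_l : Cmod l <= INR (S N) * M.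
  apply: Rle_trans (Cmod_sum_n_le _ _) _.
  apply: (@Rle_trans _ (sum_n (fun _ => M) N)); last by rewrite sum_n_const; apply: Rle_refl.
  apply: sum_n_m_le => j; rewrite Cmod_mult Cmod_im Rmult_1_l; apply: HM.
have Cmod_r m : Cmod (@sum_n C_AbelianMonoid (r m) N) <= INR (S N).
  apply: Rle_trans (Cmod_sum_n_le _ _) _.
  apply: (@Rle_trans _ (sum_n (fun _ => 1%R) N)); last by rewrite sum_n_const; lra.
  apply: sum_n_m_le => j; rewrite Cmod_im; apply: Rle_refl.
have rn : @sum_n C_AbelianMonoid (r n) N = RtoC (INR (S N)).
  have r1 j : r n j = 1.
    rewrite /r Z.sub_diag -Cexp_0; f_equal; rewrite /RtoC; f_equal; rewrite /Rdiv; ring.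
  rewrite (sum_n_ext _ _ _ r1); elim: (N) => [|K IHK]; first by rewrite sum_O.
  by rewrite sum_Sn IHK (S_INR (S K)) RtoC_plus.
have un : Cmod (u n) = (INR (S N) * (Cmod (b n) * exp (- (2 * PI * y)) ^ n))%R.
  rewrite uE rn Cmod_mult Cmod_mult Cmod_qpow_nat Cmod_R Rabs_pos_eq; last by lra.
  by rewrite /=; ring.
have := Cmod_term_le u l n N (INR (S N) * B) t Ht lenN _ _ Hu.
rewrite un => H.
apply: (Rmult_le_reg_l (INR (S N))) => //.
have -> : (INR (S N) * (M + B / (1 - t) * t ^ N) =
   INR (S N) * M + INR (S N) * B / (1 - t) * t ^ N)%R by field; lra.
apply: Rle_trans (H _ _) _.
- move=> m lemN nemn; rewrite uE sum_roots_of_unity; [ring | lia | lia].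
- move=> m; rewrite uE Cmod_mult Cmod_mult Cmod_qpow_nat.
  rewrite (Rmult_comm _ (Cmod (sum_n _ _))) (Rmult_assoc (INR (S N))).
  apply: Rmult_le_compat => //; first by apply: Cmod_ge_0.
  apply: Rmult_le_pos; first by apply: Cmod_ge_0.
  by apply/pow_le/Rlt_le/exp_pos.
- lra.
Qed.

Lemma Cauchy_estimate (b : nat -> C) (f : C -> C) (y M : R) (n : nat) :
  qser b f -> 0 < y -> (forall x, Cmod (f (x, y)) <= M) ->
  Cmod (b n) * exp (- (2 * PI * y)) ^ n <= M.
Proof.
move=> Hf y0 HM; have PI0 := PI_RGT_0.
have [B HB] := qser_coef_bounded b f (y / 2) Hf ltac:(lra).
(* As [e^(-2 pi y) = t * t], one factor [t ^ m] is absorbed by the bound [B] at height [y / 2], and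
   the other is the decay that lets [N] tend to infinity. *)
pose t := exp (- (2 * PI * (y / 2))).
have Ht : 0 <= t < 1 by apply: exp_neg_lt1; nra.
have lim : is_lim_seq (fun N => M + B / (1 - t) * t ^ N)%R (M + B / (1 - t) * 0)%R.
  apply: is_lim_seq_plus'; first by apply: is_lim_seq_const.
  apply: (is_lim_seq_scal_l _ _ (Finite 0)).
  by apply: is_lim_seq_geom; rewrite Rabs_pos_eq; lra.
have := is_lim_seq_le_loc (fun _ => Cmod (b n) * exp (- (2 * PI * y)) ^ n)%R _ _ _ _
   (is_lim_seq_const _) lim.
rewrite /= Rmult_0_r Rplus_0_r; apply; exists n => N leN.
apply: (Cauchy_estimate_avg b f y M B t n N) => // m.
have -> : exp (- (2 * PI * y)) = (t * t)%R.
  by rewrite /t -exp_plus; f_equal; field.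
rewrite Rpow_mult_distr -Rmult_assoc; apply: Rmult_le_compat_r; last by apply: HB.
by apply: pow_le; lra.
Qed.

(** * Invariant q-series without constant term vanish *)

Lemma translate_strip (x : R) : exists n : Z, Rabs (x + IZR n) <= / 2.
Proof.
have [H1 H2] := archimed (x - / 2); exists (- up (x - / 2))%Z.
rewrite opp_IZR; apply: Rabs_le; lra.
Qed.

(* On the strip |Re tau| <= 1/2, the inversion tau |-> -1/tau at least doubles
   any height below 1/2, since then |tau|^2 <= 1/2. *)
Lemma raise_height (f : C -> C) (tau : C) : SL2Z_invariant f -> upper tau ->
  exists tau' : C, f tau' = f tau /\ (/ 2 <= Im tau' \/ 2 * Im tau <= Im tau').
Proof.
move=> inv; case: tau => x y; rewrite /upper /= => y0.
have [n Hn] := translate_strip x.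
have T : f (x + IZR n, y)%R = f (x, y).
  rewrite -(inv 1 n 0 1 (x, y) ltac:(lia))%Z //; f_equal.
  rewrite /Cdiv /Cmult /Cplus /Cinv /RtoC /=; f_equal; field.
case: (Rle_lt_dec (/ 2) y) => y2.
  by exists ((x + IZR n)%R, y); split; [exact: T | left].
move: (x + IZR n)%R Hn T => a /Rabs_le_between Ha T.
have d0 : 0 < a * a + y * y by nra.
exists (- a / (a * a + y * y), y / (a * a + y * y))%R; split.
  rewrite -T -(inv 0 (-1) 1 0 (a, y) ltac:(lia))%Z //; f_equal.
  rewrite /Cdiv /Cmult /Cplus /Cinv /RtoC /=; f_equal; field; lra.
have d2 : a * a + y * y <= / 2 by nra.
right => /=; apply/(Rle_div_r (2 * y)) => //; nra.
Qed.

(** The induction is on the number of doublings of the height that suffice to reach 1/2. *)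
Lemma reduce_to_half (f : C -> C) (tau : C) : SL2Z_invariant f -> upper tau ->
  exists tau' : C, f tau' = f tau /\ / 2 <= Im tau'.
Proof.
move=> inv tau0.
have [n Hn] : exists n, / 2 <= 2 ^ n * Im tau.
  have [n Hn] := Pow_x_infinity 2 ltac:(rewrite Rabs_pos_eq; lra) (/ 2 / Im tau).
  exists n; move: (Hn n (le_n n)); rewrite Rabs_pos_eq; last by apply: pow_le; lra.
  by move=> /Rge_le/Rle_div_l; apply.
elim: n tau tau0 Hn => [|n IHn] tau tau0 Hn; first by exists tau; split=> //; move: Hn => /=; lra.
have [tau1 [e [H|H]]] := raise_height f tau inv tau0; first by exists tau1.
move: tau0; rewrite /upper => tau0.
have [||tau' [e' H']] := IHn tau1; last by exists tau'; rewrite e' e.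
  rewrite /upper; lra.
have := pow_lt 2 n ltac:(lra); move: Hn => /=; nra.
Qed.

Lemma qser_bound_half (b : nat -> C) (f : C -> C) (M : R) (tau : C) : qser b f ->
  b 0%nat = 0 -> (forall n, Cmod (b n) * exp (- (2 * PI * / 8)) ^ n <= M) ->
  / 2 <= Im tau -> Cmod (f tau) <= M / 2.
Proof.
move=> Hf b0 HM Htau.
have M0 : 0 <= M by move: (HM 0%nat); rewrite b0 Cmod_0 /=; lra.
have tau0 : upper tau by rewrite /upper; lra.
pose t := (/ 3)%R.
(* Going from height 1/8 to at least 1/2 changes the exponent by at least [3 pi / 4 > 2], and
   [e^2 >= 1 + 2]. *)
have exp3 : exp (- (2 * PI * Im tau)) <= t * exp (- (2 * PI * / 8)).
  have PI3 : 3 < PI by have := PI2_3_2; lra.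
  have e2 : exp (Ropp 2) <= t.
    rewrite exp_Ropp /t; apply: Rinv_le_contravar; first by lra.
    have := exp_ineq1_le 2; lra.
  have : exp (- (2 * PI * Im tau)) <= exp (Ropp 2 + - (2 * PI * / 8)).
    case: (Req_dec (- (2 * PI * Im tau)) (Ropp 2 + - (2 * PI * / 8))) => [->|ne]; first by lra.
    apply/Rlt_le/exp_increasing; nra.
  rewrite exp_plus; have := exp_pos (- (2 * PI * / 8)); nra.
have term n : Cmod (b n * qpow tau (Z.of_nat n)) <= M * t ^ n.
  rewrite Cmod_mult Cmod_qpow_nat.
  apply: (@Rle_trans _ (Cmod (b n) * (t * exp (- (2 * PI * / 8))) ^ n)).
    apply: Rmult_le_compat_l; first by apply: Cmod_ge_0.
    by apply: pow_incr; split=> //; apply/Rlt_le/exp_pos.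
  rewrite Rpow_mult_distr -Rmult_assoc (Rmult_comm (Cmod _)) Rmult_assoc Rmult_comm.
  apply: Rmult_le_compat_r => //; by apply: pow_le; rewrite /t; lra.
(* This is the exact value of the sum of [M / 3^n] over [1 <= n <= N]; the missing constant term is
   what brings the total down to [M / 2]. *)
have part N : Cmod (@sum_n C_AbelianMonoid (fun n => b n * qpow tau (Z.of_nat n)) N)
    <= M / 2 * (1 - t ^ N).
  elim: N => [|N IHN].
    rewrite sum_O b0 Cmult_0_l Cmod_0 /=; lra.
  rewrite sum_Sn; apply: Rle_trans (Cmod_triangle _ _) _.
  move: (term (S N)); rewrite -tech_pow_Rmult /t in IHN *; lra.
have := is_lim_seq_le _ (fun _ => M / 2)%R _ _ _ (is_Cseries_Cmod _ _ (Hf tau tau0))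
  (is_lim_seq_const _).
apply=> N; apply: Rle_trans (part N) _.
have : 0 <= t ^ N by apply: pow_le; rewrite /t; lra.
nra.
Qed.

Lemma cuspidal_eq0 (b : nat -> C) (f : C -> C) : SL2Z_invariant f -> qser b f ->
  b 0%nat = 0 -> forall tau, upper tau -> f tau = 0.
Proof.
move=> inv Hf b0.
have half M : (forall n, Cmod (b n) * exp (- (2 * PI * / 8)) ^ n <= M) ->
    forall tau, upper tau -> Cmod (f tau) <= M / 2.
  move=> HM tau tau0; have [tau' [<- Htau']] := reduce_to_half f tau inv tau0.
  exact: (qser_bound_half b).
(* Convergence at the single point [i / 8] starts the iteration, so no global bound on [f] is
   required beforehand. *)
have [B HB] := qser_coef_bounded b f (/ 8) Hf ltac:(lra).
have iter k : forall tau, upper tau -> Cmod (f tau) <= B / 2 * (/ 2) ^ k.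
  elim: k => [|k IHk] tau tau0; first by rewrite Rmult_1_r; apply: half.
  have -> : (B / 2 * (/ 2) ^ S k = B / 2 * (/ 2) ^ k / 2)%R by rewrite /=; field.
  apply: half => // n; apply: Cauchy_estimate Hf _ _; first by lra.
  by move=> x; apply: IHk; rewrite /upper /=; lra.
move=> tau tau0; apply: Cmod_eq_0; apply: Rle_antisym; last by apply: Cmod_ge_0.
have := is_lim_seq_le (fun _ => Cmod (f tau)) (fun k => B / 2 * (/ 2) ^ k)%R _ (B / 2 * 0)%R
  (fun k => iter k tau tau0) (is_lim_seq_const _).
rewrite /= Rmult_0_r; apply; rewrite -(Rmult_0_r (B / 2)).
apply: (is_lim_seq_scal_l _ _ (Finite 0)).
by apply: is_lim_seq_geom; rewrite Rabs_pos_eq; lra.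
Qed.

(** * Modular functions and their principal parts *)

(** The forward direction raises the nominal pole order of an expansion; the backward one strips
    polar terms known to vanish. *)
Lemma is_Cseries_shift (u v : nat -> C) (d : nat) (l : C) :
  (forall n, (n < d)%nat -> v n = 0) -> (forall n, v (d + n)%nat = u n) ->
  is_Cseries u l <-> is_Cseries v l.
Proof.
case: d => [|d] v0 vu.
  by split; apply: is_series_ext => n; rewrite -vu.
have s0 : @sum_n C_AbelianMonoid v (Nat.pred (S d)) = RtoC 0.
  by apply: sum_n_eq0 => i /ssrnat.leP lei; apply: v0; simpl in lei; lia.
split=> H.
- apply: (is_series_decr_n _ (S d)); first by lia.
  rewrite [sum_n _ _]s0 opp_zero plus_zero_r.
  by apply: is_series_ext H => n; rewrite vu.
- apply: (is_series_ext (fun n => v (S d + n)%nat)); first by move=> n; rewrite vu.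
  apply: is_series_incr_n; first by lia.
  by rewrite [sum_n _ _]s0 plus_zero_r.
Qed.

Lemma coefq_nat (s : qseries) (n : nat) :
  coefq s (Z.of_nat n - Z.of_nat (qs_pole s)) = qs_coef s n.
Proof.
rewrite /coefq Z.sub_add; case: Z.ltb_spec => [|_]; first by lia.
by rewrite Nat2Z.id.
Qed.

Lemma coefq_lt_pole (s : qseries) (z : Z) :
  (z < - Z.of_nat (qs_pole s))%Z -> coefq s z = 0.
Proof. by move=> Hz; rewrite /coefq; case: Z.ltb_spec => //; lia. Qed.

(** [qs_pole] only bounds the order of the pole, so two expansions can be brought to a common [P]
    and added termwise. Values of [g] below [- P] are discarded. *)
Definition repole (P : nat) (g : Z -> C) : qseries :=
  QSeries P (fun n => g (Z.of_nat n - Z.of_nat P)%Z).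

Lemma coefq_repole (P : nat) (g : Z -> C) (z : Z) :
  coefq (repole P g) z = if (z <? - Z.of_nat P)%Z then RtoC 0 else g z.
Proof.
rewrite /coefq /=; case: Z.ltb_spec; case: Z.ltb_spec => H1 H2 //; try lia.
by f_equal; lia.
Qed.

Lemma has_qexp_repole (f : C -> C) (s : qseries) (P : nat) :
  (qs_pole s <= P)%nat -> has_qexp f s -> has_qexp f (repole P (coefq s)).
Proof.
move=> leP Hf tau tau0.
refine (proj1 (is_Cseries_shift _ _ (P - qs_pole s) _ _ _) (Hf tau tau0)) => n /=.
  by move=> Hn; rewrite coefq_lt_pole; [ring | lia].
have -> : (Z.of_nat (P - qs_pole s + n) - Z.of_nat P =
           Z.of_nat n - Z.of_nat (qs_pole s))%Z by lia.
by rewrite coefq_nat.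
Qed.

Lemma has_qexp_axpy (c : C) (f g : C -> C) (s t : qseries) :
  has_qexp f s -> has_qexp g t ->
  has_qexp (fun tau => c * f tau + g tau)
    (repole (qs_pole s + qs_pole t) (fun z => c * coefq s z + coefq t z)).
Proof.
move=> Hf Hg tau tau0; set P := (_ + _)%nat.
have Hf' := has_qexp_repole f s P ltac:(rewrite /P; lia) Hf tau tau0.
have Hg' := has_qexp_repole g t P ltac:(rewrite /P; lia) Hg tau tau0.
apply: is_series_ext (is_series_plus _ _ _ _ (is_series_scal c _ _ Hf') Hg') => n.
rewrite /plus /scal /= /mult /=; ring.
Qed.

(** This single form of linearity serves both differences ([c = -1]) and the term-by-term
    construction of [Omega]. *)
Lemma modular_with_pp_axpy (c : C) (f1 f2 : C -> C) (g1 g2 g : qseries) :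
  modular_with_pp f1 g1 -> modular_with_pp f2 g2 ->
  (forall z, (z <= 0)%Z -> coefq g z = c * coefq g1 z + coefq g2 z) ->
  modular_with_pp (fun tau => c * f1 tau + f2 tau) g.
Proof.
move=> [[hol1 inv1 _] [s1 q1 e1]] [[hol2 inv2 _] [s2 q2 e2]] Hg.
have q := has_qexp_axpy c _ _ _ _ q1 q2.
split; first split.
- move=> tau tau0; apply: (@ex_derive_plus C_AbsRing C_NormedModule); last by apply: hol2.
  have [l Hl] := hol1 tau tau0; exists (scal c l).
  apply: filterdiff_ext_lin (filterdiff_scal_r_fct c _ _ Cmult_comm Hl) _ => y.
  rewrite /scal /= /mult /=; ring.
- by move=> a b c' d tau det tau0; rewrite inv1 // inv2.
- by eexists; apply: q.
eexists; first by apply: q.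
move=> z z0; rewrite coefq_repole Hg // -e1 // -e2 //.
case: Z.ltb_spec => // Hz; rewrite !coefq_lt_pole; [ring | lia | lia].
Qed.

(** Dropping the first [qs_pole s] terms, which vanish, leaves a [qser] with zero constant
    coefficient, to which [cuspidal_eq0] applies. *)
Lemma modular_with_pp_eq0 (f : C -> C) (g : qseries) : modular_with_pp f g ->
  (forall z, (z <= 0)%Z -> coefq g z = 0) -> forall tau, upper tau -> f tau = 0.
Proof.
move=> [[_ inv _] [s q e]] g0.
have s0 z : (z <= 0)%Z -> coefq s z = 0 by move=> z0; rewrite e // g0.
apply: (cuspidal_eq0 (fun n => coefq s (Z.of_nat n)) f inv); last by apply: s0.
move=> tau tau0.
refine (proj2 (is_Cseries_shift _ _ (qs_pole s) _ _ _) (q tau tau0)) => n.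
  by move=> Hn; rewrite -coefq_nat s0; [ring | lia].
rewrite -coefq_nat.
by have -> : (Z.of_nat (qs_pole s + n) - Z.of_nat (qs_pole s) = Z.of_nat n)%Z by lia.
Qed.

Lemma modular_with_pp_unique (f1 f2 : C -> C) (g : qseries) :
  modular_with_pp f1 g -> modular_with_pp f2 g -> eq_on_upper f1 f2.
Proof.
move=> H1 H2 tau tau0.
have H := modular_with_pp_axpy (-1) f1 f2 g g (QSeries 0 (fun _ => 0)) H1 H2.
have z0 z : coefq (QSeries 0 (fun _ => 0)) z = 0 by rewrite /coefq; case: Z.ltb.
have := modular_with_pp_eq0 _ _ (H _) (fun z _ => z0 z) tau tau0.
move=> E; rewrite -[f1 tau]Cplus_0_r -E; first by ring.
by move=> z _; rewrite z0; ring.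
Qed.

Lemma coefq_fps_one (d : nat) (z : Z) :
  coefq (QSeries d fps_one) z = if (z =? - Z.of_nat d)%Z then RtoC 1 else RtoC 0.
Proof.
rewrite /coefq /=; case: Z.ltb_spec => Hz; case: Z.eqb_spec => e //; try lia.
  by rewrite e Z.add_opp_diag_l.
by case E: (Z.to_nat _) => [|n] //; lia.
Qed.

Lemma modular_with_pp_cst (c : C) :
  modular_with_pp (fun _ => c) (repole 0 (fun z => if (z =? 0)%Z then c else RtoC 0)).
Proof.
have q : has_qexp (fun _ => c) (repole 0 (fun z => if (z =? 0)%Z then c else RtoC 0)).
  move=> tau _; apply: filterlim_ext (filterlim_const c) => n.
  rewrite (sum_n_single _ 0%nat) //= => [|i _ i0]; first by rewrite qpow_0; ring.
  by case: Z.eqb_spec => [|_]; [lia | ring].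
split; first split.
- by move=> tau _; apply: ex_derive_const.
- by [].
- by eexists; apply: q.
by eexists; first by apply: q.
Qed.

Lemma modular_with_pp_ext (f1 f2 : C -> C) (g1 g2 : qseries) :
  (forall tau, f1 tau = f2 tau) -> eq_mod_Oq g1 g2 ->
  modular_with_pp f1 g1 -> modular_with_pp f2 g2.
Proof.
move=> /functional_extensionality <- eg [w [s q e]]; split=> //.
by exists s => // z z0; rewrite e // eg.
Qed.

(** Together with uniqueness, this turns the term [p(k) X_0] into the constant [p(k)] of formula
    (i). *)
Lemma is_J0_1 : is_J 0 (fun _ => 1).
Proof.
apply: modular_with_pp_ext (modular_with_pp_cst 1) => // z z0.
rewrite coefq_repole coefq_fps_one; case: Z.ltb_spec => // Hz.
by case: Z.eqb_spec => //; lia.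
Qed.

(** Up to [O(q)] each [J d] is the single monomial [q^(-d)], so substituting it for [X_d] restores
    the coefficients one at a time. *)
Lemma modular_with_pp_PP_upto (J : nat -> C -> C) (g : qseries) (m : nat) :
  (forall d, is_J d (J d)) ->
  modular_with_pp (fun tau => peval (PP_upto g m) (fun d => J d tau))
    (repole m (coefq g)).
Proof.
move=> HJ; elim: m => [|m IHm].
  have H := modular_with_pp_axpy (coefq g 0) _ _ _ _ (repole 0 (coefq g)) (HJ 0%nat)
    (modular_with_pp_cst 0).
  apply: modular_with_pp_ext (H _) => // [tau|z z0] /=; first by ring.
  rewrite !coefq_repole coefq_fps_one; case: Z.ltb_spec => Hz.
    by case: Z.eqb_spec => [|_]; [lia | ring].
  have -> : z = 0%Z by lia.
  by rewrite /=; ring.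
apply: modular_with_pp_axpy (HJ (S m)) IHm _ => z z0.
rewrite !coefq_repole coefq_fps_one.
case: Z.eqb_spec => [->|ne]; case: Z.ltb_spec => H1; case: Z.ltb_spec => H2;
  try lia; try ring.
Qed.

(** * Partition numbers *)

(* The module confines the ssrnat notations, which would change the reading of
   the statement of the theorem. *)
Module PartitionCount.
Import mathcomp.boot.all_boot.

Lemma sum_n_truncate (u : nat -> C) (k n : nat) : (k <= n)%N ->
  (forall i, (k < i <= n)%N -> u i = 0) -> sum_n u n = sum_n u k.
Proof.
elim: n => [|n IHn]; first by rewrite leqn0 => /eqP ->.
rewrite leq_eqVlt => /orP [/eqP -> //|ltkn] u0.
rewrite sum_Sn u0 ?ltkn ?leqnn // IHn //; first exact: Cplus_0_r.
by move=> i /andP [ki /leqW i_n]; apply: u0; rewrite ki.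
Qed.

(** Coefficientwise, this is [F = f + q^m F] for [F = f / (1 - q^m)]. *)
Lemma fps_mul_geom_rec (f : fps) (m n : nat) : (0 < m)%N ->
  fps_mul f (fps_geom m) n =
  f n + (if (m <= n)%N then fps_mul f (fps_geom m) (n - m)%N else 0).
Proof.
move=> m0; rewrite {1}/fps_mul.
case: (leqP m n) => [lemn|ltnm]; last first.
  rewrite (sum_n_single _ n) //; first by rewrite subnn /fps_geom dvdn0; ring.
  move=> i lein /eqP nin; rewrite /fps_geom gtnNdvd; first by ring.
    by rewrite subn_gt0 ltn_neqAle nin.
  exact: leq_ltn_trans (leq_subr _ _) ltnm.
case: n lemn => [|n] lemn; first by move: m0; rewrite ltnNge lemn.
rewrite sum_Sn subnn [fps_geom m 0%N]/fps_geom dvdn0.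
(* For the discarded indices, [0 < n + 1 - i < m], so [m] does not divide the difference. *)
rewrite (sum_n_truncate _ (n.+1 - m)).
- rewrite /fps_mul (sum_n_ext_loc _ (fun i => f i * fps_geom m (n.+1 - m - i)%N)).
    change (@plus C_AbelianMonoid) with Cplus; ring.
  move=> i /leP lei; congr (_ * _); rewrite /fps_geom.
  have lein := leq_trans lei (leq_subr _ _).
  have lem : (m <= n.+1 - i)%N by rewrite leq_subRL // addnC -leq_subRL.
  by rewrite subnAC [X in _ = if X then _ else _]dvdn_subl.
- by rewrite leq_subLR -add1n leq_add2r.
- move=> i /andP [lti lei]; rewrite /fps_geom gtnNdvd; first by ring.
    by rewrite subn_gt0 ltnS.
  by rewrite ltn_subLR ?(leq_trans lei) // addnC -ltn_subLR.
Qed.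

Lemma euler2_partial_rec (N n : nat) :
  euler2_partial N.+1 n = euler2_partial N n +
    (if (N.+2 <= n)%N then euler2_partial N.+1 (n - N.+2)%N else 0).
Proof. exact: fps_mul_geom_rec. Qed.

(** Partial summation multiplies by [1 / (1 - q)] and so restores the factor missing from the
    product: this is the coefficient of [q^n] in the product of [1 / (1 - q^m)] over
    [1 <= m <= N + 1]. *)
Definition euler2_sum (N n : nat) : C := sum_n (euler2_partial N) n.

Lemma euler2_sum0 (n : nat) : euler2_sum 0 n = 1.
Proof.
elim: n => [|n IHn]; first by rewrite /euler2_sum sum_O.
by rewrite /euler2_sum sum_Sn [sum_n _ _]IHn; apply: Cplus_0_r.
Qed.

Lemma euler2_sum_rec (N n : nat) :
  euler2_sum N.+1 n = euler2_sum N n +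
    (if (N.+2 <= n)%N then euler2_sum N.+1 (n - N.+2)%N else 0).
Proof.
elim: n => [|n IHn]; first by rewrite /euler2_sum !sum_O euler2_partial_rec.
rewrite /euler2_sum !sum_Sn -!/(euler2_sum _ _) IHn euler2_partial_rec.
change (@plus C_AbelianMonoid) with Cplus.
case: (ltngtP N.+2 n.+1) => [lt|gt|e].
- rewrite subSn // /euler2_sum sum_Sn -!/(euler2_sum _ _) -ltnS lt.
  change (@plus C_AbelianMonoid) with Cplus; ring.
- rewrite leqNgt (leq_trans _ gt) //=; ring.
- case: e => <-; rewrite subnn /euler2_sum sum_O ltnn; ring.
Qed.

(** The list follows [euler2_sum_rec]: a partition with parts at most [N + 2] either has no part
    [N + 2], or starts with one that can be removed. *)
Lemma partitions_enum (N n : nat) : exists l : seq (seq nat),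
  [/\ uniq l,
      forall s, (s \in l) = [&& path geq N.+1 s, all (fun i => 0 < i)%N s & sumn s == n]
    & RtoC (INR (size l)) = euler2_sum N n].
Proof.
elim: N n => [|N IHN] n.
  exists [:: nseq n 1%N]; split=> [//|s|]; last by rewrite euler2_sum0.
  rewrite inE; apply/eqP/and3P => [->|[]].
    split; last by rewrite sumn_nseq mul1n.
      by elim: (n) => //= k ->.
    by rewrite all_nseq orbT.
  move=> sp s0 /eqP <-.
  elim: s sp s0 => //= x s IHs /andP [x1 sp] /andP [x0 s0].
  have x1' : x = 1%N by apply/eqP; rewrite eqn_leq x0 andbT.
  by rewrite x1' in sp *; rewrite add1n /= -IHs.
(* Removing a part [N + 2] keeps the bound on the parts and lowers only the sum, hence a strong
   induction on [n] inside the one on [N]. *)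
elim/ltn_ind: n => n IHn.
have [l1 [u1 m1 s1]] := IHN n.
case: (leqP N.+2 n) => [leNn|ltnN]; last first.
  exists l1; split=> // [s|]; last by rewrite euler2_sum_rec leqNgt ltnN s1 /=; ring.
  rewrite m1; apply/and3P/and3P => -[sp s0 sn]; split=> //; case: s sp s0 sn => //= x s.
    by move=> /andP [x1 ->] _ _; rewrite andbT; apply: leq_trans x1 _.
  move=> /andP [x1 ->] _ /eqP sn; rewrite andbT /=; move: ltnN; rewrite -sn ltnS.
  by apply: leq_trans; apply: leq_addr.
have [l2 [u2 m2 s2]] := IHn (n - N.+2)%N ltac:(by rewrite ltn_subrL /= (leq_trans _ leNn)).
exists (l1 ++ [seq N.+2 :: s | s <- l2]); split.
- rewrite cat_uniq u1 map_inj_uniq ?u2; last by move=> s t [].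
  rewrite andbT /=; apply/hasPn => _ /mapP [s _ ->].
  by rewrite m1 /= ltnn.
- move=> s; rewrite mem_cat m1.
  case: s => [|x s].
    by rewrite /= (negbTE (_ : [::] \notin _)) ?orbF //; apply/mapP => -[].
  rewrite /=; case: (eqVneq x N.+2) => [->|nx].
    rewrite ltnn leqnn /= mem_map; last by move=> ? ? [].
    rewrite m2; congr [&& _, _ & _].
    by apply/eqP/eqP => [->|<-]; rewrite ?subnKC // addKn.
  have -> : (x :: s \in [seq N.+2 :: s0 | s0 <- l2]) = false.
    by apply/negP => /mapP [s' _ [ex _]]; rewrite ex eqxx in nx.
  by rewrite orbF [in RHS]leq_eqVlt (negbTE nx) /= ltnS.
- rewrite size_cat size_map plus_INR RtoC_plus s1 s2.
  by rewrite [in RHS]euler2_sum_rec leNn.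
Qed.

(** With [N = n] the bound [n + 1] on the parts excludes no partition of [n], so the enumeration has
    as many elements as the finite set defining [p n]. *)
Lemma sum_euler2 (n : nat) : sum_n euler2 n = RtoC (INR (p n)).
Proof.
have [l [ul ml sl]] := partitions_enum n n.
have -> : sum_n euler2 n = euler2_sum n n.
  apply: sum_n_ext_loc => i /leP lein; by rewrite euler2_partial_stable.
rewrite -sl; congr (RtoC (INR _)).
rewrite /p cardE -(size_map (fun s : n.-bseq 'I_n.+1 => map val s)).
apply/perm_size/uniq_perm => //.
  rewrite map_inj_uniq ?enum_uniq // => s t /(inj_map val_inj) e.
  exact: val_inj.
move=> s; rewrite ml; apply/and3P/mapP => [[sp s0 sn]|].
  have bnd x : x \in s -> (x < n.+1)%N.
    move=> xs; rewrite ltnS -(eqP sn); elim: (s) xs => //= y r IHr.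
    rewrite inE => /orP [/eqP ->|/IHr h]; first exact: leq_addr.
    exact: leq_trans h (leq_addl _ _).
  have szs : (size s <= n)%N.
    rewrite -(eqP sn); elim: (s) s0 => //= y r IHr /andP [y0 /IHr h].
    by rewrite -add1n leq_add.
  have szm : (size (map (@inord n) s) <= n)%N by rewrite size_map.
  have vs : map val (map (@inord n) s) = s.
    by rewrite -map_comp -[RHS]map_id; apply/eq_in_map => x /bnd xn /=; rewrite inordK.
  exists (Bseq szm); last by rewrite /= vs.
  rewrite mem_enum inE /is_partition /= vs s0 sn !andbT.
  exact: path_sorted sp.
move=> [t]; rewrite mem_enum inE => /and3P [tp t0 tn] ->; split=> //.
case: (map val t) tp tn => //= x r -> /eqP <-; rewrite andbT.
by apply: leqW; apply: leq_addr.
Qed.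

End PartitionCount.

(** * Evaluation of [Omega] and the two formulas for [Z_k] *)

Lemma is_Z_Omega (J : nat -> C -> C) (k : nat) : (forall d, is_J d (J d)) ->
  is_Z k (fun tau => peval (Omega k) (fun d => J d tau)).
Proof.
move=> HJ; apply: modular_with_pp_ext (modular_with_pp_PP_upto J (Zk_target k) k HJ) => // z _.
rewrite coefq_repole; case: Z.ltb_spec => // Hz.
by rewrite coefq_lt_pole.
Qed.

Lemma peval_PP_upto (s : qseries) (m : nat) (x : nat -> C) :
  peval (PP_upto s m) x =
  @sum_n C_AbelianMonoid (fun n => coefq s (- Z.of_nat n) * x n) m.
Proof.
elim: m => [|m IHm]; first by rewrite sum_O.
by rewrite sum_Sn -IHm; apply: Cplus_comm.
Qed.

Lemma sum_n_rev (u : nat -> C) (n : nat) :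
  @sum_n C_AbelianMonoid u n = @sum_n C_AbelianMonoid (fun i => u (n - i)%nat) n.
Proof.
elim: n => [|n IHn]; first by rewrite !sum_O.
rewrite sum_Sn IHn /sum_n (sum_Sn_m _ 0 (S n)); last by lia.
by rewrite -sum_n_m_S; apply: Cplus_comm.
Qed.

Lemma Abel_summation (c y : nat -> C) (K : nat) :
  @sum_n C_AbelianMonoid (fun n => c n * y n) (S K) =
  @sum_n C_AbelianMonoid c (S K) * y (S K) +
  @sum_n C_AbelianMonoid (fun n => @sum_n C_AbelianMonoid c n * (y n - y (S n))) K :> C.
Proof.
elim: K => [|K IHK].
  rewrite !sum_Sn !sum_O; change (@plus C_AbelianMonoid) with Cplus; ring.
rewrite sum_Sn IHK (sum_Sn c (S K)) (sum_Sn (fun n => _ * _) K); cbv beta.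
change (@plus C_AbelianMonoid) with Cplus; ring.
Qed.

Lemma p_0 : p 0 = 1%nat.
Proof.
have := PartitionCount.sum_euler2 0; rewrite sum_O => /(f_equal Re) /= e.
by apply: INR_eq; rewrite -e.
Qed.

Lemma peval_Omega (k : nat) (x : nat -> C) : (1 <= k)%nat ->
  peval (Omega k) x = RtoC (INR (p k)) * x 0%nat + (x k - x (k - 1)%nat) +
    @sum_n_m C_AbelianMonoid
      (fun n => RtoC (INR (p n)) * (x (k - n)%nat - x (k - n - 1)%nat)) 1 (k - 1).
Proof.
case: k => [|k] hk; first by lia.
(* Reversal indexes the sum by the coefficients of [euler2] in increasing order, whose partial sums
   are the partition numbers. *)
rewrite /Omega /PP peval_PP_upto sum_n_rev.
have -> : @sum_n C_AbelianMonoid (fun i => coefq (Zk_target (S k))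
     (- Z.of_nat (S k - i)) * x (S k - i)%nat) (S k) =
   @sum_n C_AbelianMonoid (fun i => euler2 i * x (S k - i)%nat) (S k).
  apply: sum_n_ext_loc => i lei; rewrite -[euler2 i](coefq_nat (Zk_target (S k)) i).
  by do 2 f_equal; rewrite [qs_pole _]/=; lia.
rewrite Abel_summation PartitionCount.sum_euler2 Nat.sub_diag.
have -> : (S k - 1 = k)%nat by lia.
rewrite -Cplus_assoc; congr (_ + _).
rewrite /sum_n sum_Sn_m; last by lia.
change (@plus C_AbelianMonoid) with Cplus; congr (_ + _).
  (* The [n = 0] term of the Abel sum has weight [p 0 = 1] and is the isolated difference
     [x k - x (k - 1)]. *)
  rewrite -/(sum_n _ 0) PartitionCount.sum_euler2 p_0 Nat.sub_0_r.
  have -> : (S k - 1 = k)%nat by lia.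
  by rewrite Cmult_1_l.
apply: sum_n_m_ext => n; rewrite -/(sum_n _ n) PartitionCount.sum_euler2.
by have -> : (S k - S n = S k - n - 1)%nat by lia.
Qed.

Theorem theorem1p1 (J : nat -> C -> C) (HJ : forall d : nat, is_J d (J d))
    (k : nat) (hk : (1 <= k)%nat) :
  (exists Z : C -> C,
     is_Z k Z /\ forall Z' : C -> C, is_Z k Z' -> eq_on_upper Z' Z) /\
  (forall Z : C -> C, is_Z k Z ->
     (forall tau : C, upper tau ->
        Z tau = RtoC (INR (p k)) + (J k tau - J (k - 1)%nat tau) +
          @sum_n_m C_AbelianMonoid
            (fun n : nat => RtoC (INR (p n)) *
               (J (k - n)%nat tau - J (k - n - 1)%nat tau)) 1 (k - 1)) /\
     (forall tau : C, upper tau ->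
        Z tau = peval (Omega k) (fun d : nat => J d tau))).
Proof.
have HO := is_Z_Omega J k HJ.
split; first by eexists; split; [exact: HO | move=> Z' HZ'; apply: modular_with_pp_unique HZ' HO].
move=> Z HZ; have E := modular_with_pp_unique _ _ _ HZ HO.
split=> tau tau0; rewrite E // peval_Omega //.
(* The boundary term of the Abel summation carries [J 0], which uniqueness identifies with 1. *)
by rewrite (modular_with_pp_unique _ _ _ (HJ 0%nat) is_J0_1 tau tau0) Cmult_1_r.
Qed.
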